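(* Let $l_2,l_3,l_4$ be positive real numbers with $l_3=l_2+l_4-2$, $l_2\neq 2$, $l_4\neq 2$ and $l_2\neq \tfrac{8}{3}$. Let $X\subseteq\mathbb{R}^4$ (coordinates $x,y,u,v$) be the configuration space of the four-bar linkage, i.e. the set of common real zeros of $$p_1=x^2+y^2-l_2^2,\qquad p_2=(u-2)^2+v^2-l_3^2,\qquad p_3=(u-x)^2+(v-y)^2-l_4^2 .$$ Then the point $(l_2,0,l_2+l_4,0)\in X$ is not a manifold point of $X$.
   Context: A $d$-dimensional analytic submanifold of $\mathbb{R}^n$ is a set $M\subseteq\mathbb{R}^n$ such that for every $p\in M$ there are a Euclidean open neighborhood $U\subseteq\mathbb{R}^n$ of $p$ and a real-analytic diffeomorphism $\phi\colon U\to V$ onto an open set $V\subseteq\mathbb{R}^n$ with $M\cap U=\{x\in U : \phi_{d+1}(x)=\dots=\phi_n(x)=0\}$. A point $p$ of a set $X\subseteq\mathbb{R}^n$ is a manifold point of $X$ if there is a Euclidean open neighborhood $U$ of $p$ such that $X\cap U$ is an analytic submanifold of $\mathbb{R}^n$ (of some dimension $0\le d\le n$). *)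

(* Defs.v *)
From HB Require Import structures.
From mathcomp Require Import all_boot all_order all_algebra.
From mathcomp Require Import all_classical all_reals all_analysis.

Set Implicit Arguments.
Unset Strict Implicit.
Unset Printing Implicit Defensive.

Import Order.TTheory GRing.Theory Num.Theory.
Import numFieldNormedType.Exports.

Local Open Scope classical_set_scope.
Local Open Scope ring_scope.

Definition monomial (R : realType) (n : nat) (h : 'rV[R]_n)
    (al : {ffun 'I_n -> nat}) : R :=
  \prod_(i < n) h ord0 i ^+ al i.

Definition box_sum (R : realType) (n : nat) (u : {ffun 'I_n -> nat} -> R)
    (N : nat) : R :=
  \sum_(al : {ffun 'I_n -> 'I_N}) u [ffun i => nat_of_ord (al i)].

(* The n-fold series sum_al u al converges absolutely with sum s; given
   absolute convergence the sum does not depend on the order of summation, so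
   it may be computed along the boxes [0, N)^n. *)
Definition multi_series_to (R : realType) (n : nat)
    (u : {ffun 'I_n -> nat} -> R) (s : R) : Prop :=
  cvgn (box_sum (fun al => `|u al|)) /\ box_sum u N @[N --> \oo] --> s.

Definition analytic_at (R : realType) (n : nat) (f : 'rV[R]_n -> R)
    (a : 'rV[R]_n) : Prop :=
  exists c : {ffun 'I_n -> nat} -> R,
    \forall x \near a, multi_series_to (fun al => c al * monomial (x - a) al)
      (f x).

Definition analytic_map_on (R : realType) (n m : nat) (U : set 'rV[R]_n)
    (f : 'rV[R]_n -> 'rV[R]_m) : Prop :=
  forall a, U a -> forall j : 'I_m, analytic_at (fun x => f x ord0 j) a.

(* [phi] restricts to a real-analytic diffeomorphism U -> V; its values outside
   the open set U play no role. *)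
Definition analytic_diffeo (R : realType) (n : nat) (U V : set 'rV[R]_n)
    (phi : 'rV[R]_n -> 'rV[R]_n) : Prop :=
  [/\ open U, open V, phi @` U = V, analytic_map_on U phi &
    exists psi : 'rV[R]_n -> 'rV[R]_n,
      analytic_map_on V psi /\ (forall x, U x -> psi (phi x) = x)].

(* Coordinates are numbered from 0, so phi_{d+1}, ..., phi_n are the
   coordinates i : 'I_n with d <= i. *)
Definition analytic_submanifold (R : realType) (n d : nat)
    (M : set 'rV[R]_n) : Prop :=
  forall p, M p ->
    exists (U V : set 'rV[R]_n) (phi : 'rV[R]_n -> 'rV[R]_n),
      [/\ U p, analytic_diffeo U V phi &
        M `&` U =
          [set x | U x /\ forall i : 'I_n, (d <= i)%N -> phi x ord0 i = 0]].

Definition manifold_point (R : realType) (n : nat) (X : set 'rV[R]_n)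
    (p : 'rV[R]_n) : Prop :=
  X p /\
  exists U : set 'rV[R]_n, [/\ open U, U p &
    exists2 d : nat, (d <= n)%N & analytic_submanifold d (X `&` U)].

Definition fourbar_p1 (R : realType) (l2 : R) (z : 'rV[R]_4) : R :=
  let x := z ord0 0 in let y := z ord0 1 in
  x ^+ 2 + y ^+ 2 - l2 ^+ 2.

Definition fourbar_p2 (R : realType) (l3 : R) (z : 'rV[R]_4) : R :=
  let u := z ord0 2 in let v := z ord0 3 in
  (u - 2) ^+ 2 + v ^+ 2 - l3 ^+ 2.

Definition fourbar_p3 (R : realType) (l4 : R) (z : 'rV[R]_4) : R :=
  let x := z ord0 0 in let y := z ord0 1 in
  let u := z ord0 2 in let v := z ord0 3 in
  (u - x) ^+ 2 + (v - y) ^+ 2 - l4 ^+ 2.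

Definition fourbar_space (R : realType) (l2 l3 l4 : R) : set 'rV[R]_4 :=
  [set z | [/\ fourbar_p1 l2 z = 0, fourbar_p2 l3 z = 0 &
               fourbar_p3 l4 z = 0]].

Definition row4 (R : realType) (x y u v : R) : 'rV[R]_4 :=
  \row_(i < 4) [:: x; y; u; v]`_i.

(* Main.v *)
(** At the flat configuration p = (l2, 0, l2 + l4, 0) the linkage has a node: two
    branches pass through p with velocities that differ by a nonzero multiple of
    the v-direction (0, 0, 0, 1).  Near a manifold point, in contrast, the set of
    velocities at p of curves lying in X is a linear space, by the chain rule for
    the chart and its inverse (analytic maps have a first-order Taylor expansion
    with quadratic remainder).  So X would contain a curve with velocity
    (0, 0, 0, k), k <> 0, and comparing second-order terms in the three equations
    along such a curve gives l4 = l3, i.e. l2 = 2. *)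

Require Import Defs.
From HB Require Import structures.
From mathcomp Require Import all_boot all_order all_algebra.
From mathcomp Require Import all_classical all_reals all_analysis.
From mathcomp Require Import ring lra.

Set Implicit Arguments.
Unset Strict Implicit.
Unset Printing Implicit Defensive.

Import Order.TTheory GRing.Theory Num.Theory.
Import numFieldNormedType.Exports.

Local Open Scope classical_set_scope.
Local Open Scope ring_scope.

(** * First-order Taylor expansion of analytic functions *)

Definition mdeg1 (n : nat) (i : 'I_n) : {ffun 'I_n -> nat} :=
  [ffun j => (j == i : nat)].

(** Isolates the affine part of a power series, leaving terms of total degree at least 2. The box
    needs side at least 2 to contain the exponents of degree one. *)
Lemma box_sum_degree (R : realType) (n N : nat)
    (u : {ffun 'I_n -> nat} -> R) :
  box_sum u N.+2 = u [ffun=> 0%N] + \sum_(i < n) u (mdeg1 i) +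
    \sum_(al : {ffun 'I_n -> 'I_N.+2} | (1 < \sum_i al i)%N)
      u [ffun i => nat_of_ord (al i)].
Proof.
pose E (i : 'I_n) : {ffun 'I_n -> 'I_N.+2} := [ffun j => inord (j == i)].
have EE i j : E i j = (j == i) :> nat.
  by rewrite ffunE inordK //; case: (j == i).
have E_inj : {in 'I_n &, injective E}.
  move=> i j _ _ /ffunP /(_ i) /(congr1 val) /=; rewrite !EE eqxx.
  by case: eqP.
rewrite /box_sum.
rewrite (bigID (fun al : {ffun 'I_n -> 'I_N.+2} => (1 < \sum_i al i)%N)) /=.
rewrite addrC; congr (_ + _).
rewrite (bigD1 [ffun=> ord0]) /=; last first.
  by rewrite big1 // => i _; rewrite ffunE.
congr (u _ + _); first by apply/ffunP => i; rewrite !ffunE.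
(* A nonzero exponent of total degree at most 1 has a single entry 1, so it is some [E i], the copy
   of [mdeg1 i] inside the box. *)
rewrite (eq_bigl (fun al => al \in E @: 'I_n)); last first.
  move=> al; apply/andP/imsetP => [[]|[i _ ->]].
    rewrite -leqNgt => dle al0.
    have [i ali] : exists i, al i != ord0.
      apply/existsP; apply: contraR al0 => /existsPn al0.
      apply/eqP/ffunP => i; rewrite ffunE; apply/eqP.
      by have := al0 i; rewrite negbK.
    exists i => //; apply/ffunP => j; apply/val_inj => /=; rewrite EE.
    have ali0 : (0 < al i)%N by rewrite lt0n.
    move: dle; rewrite (bigD1 i) //=.
    have [->|ji] := eqVneq j i; first by case: (al i : nat) ali0 => [|[|]].
    rewrite (bigD1 j) //=; case: (al i : nat) ali0 => // k _.
    by case: (al j : nat) => // k'; rewrite !(addSn, addnS).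
  split.
    rewrite -leqNgt (bigD1 i) //= big1 ?EE ?eqxx // => j /negPf ji.
    by rewrite EE ji.
  apply/eqP => /ffunP /(_ i) /(congr1 (@nat_of_ord _)).
  by rewrite EE eqxx ffunE.
rewrite big_imset //=; apply: eq_bigr => i _; congr u; apply/ffunP => j.
by rewrite [LHS]ffunE EE ffunE.
Qed.

Lemma monomial_const (R : realType) (n : nat) (r : R)
    (al : {ffun 'I_n -> nat}) :
  monomial (const_mx r) al = r ^+ (\sum_i al i).
Proof.
by rewrite /monomial -prodrXr; apply: eq_bigr => i _; rewrite mxE.
Qed.

Lemma monomial0 (R : realType) (n : nat) (h : 'rV[R]_n) :
  monomial h [ffun=> 0%N] = 1.
Proof. by rewrite /monomial big1 // => i _; rewrite ffunE expr0. Qed.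

Lemma monomial_mdeg1 (R : realType) (n : nat) (h : 'rV[R]_n) (i : 'I_n) :
  monomial h (mdeg1 i) = h ord0 i.
Proof.
rewrite /monomial (bigD1 i) //= ffunE eqxx expr1 big1 ?mulr1 // => j /negPf ji.
by rewrite ffunE ji expr0.
Qed.

Lemma normr_monomial_le (R : realType) (n : nat) (h : 'rV[R]_n) (rho : R)
    (al : {ffun 'I_n -> nat}) :
  (forall i, `|h ord0 i| <= rho) -> `|monomial h al| <= rho ^+ (\sum_i al i).
Proof.
move=> hrho; rewrite /monomial normr_prod -prodrXr.
apply: ler_prod => i _; rewrite normr_ge0 normrX lerXn2r ?nnegrE //.
exact: le_trans (hrho i).
Qed.

(** The series converges absolutely at the corner [a + const_mx r]. Passing from this corner to a
    point within [rho] of [a] scales a term of degree d >= 2 by at most (rho/r)^d <= (rho/r)^2, so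
    the remainder is at most (rho/r)^2 times a bound on the absolute series at the corner. *)
Lemma analytic_at_taylor1 (R : realType) (n : nat) (f : 'rV[R]_n -> R)
    (a : 'rV[R]_n) : analytic_at f a ->
  exists (g : 'I_n -> R) (C r : R), 0 < r /\ forall (x : 'rV[R]_n) (rho : R),
    0 <= rho <= r -> (forall i, `|x ord0 i - a ord0 i| <= rho) ->
    `|f x - f a - \sum_i g i * (x ord0 i - a ord0 i)| <= C * rho ^+ 2.
Proof.
case=> c /nbhs_ballP [e /= e0 fc].
pose r := e / 2; have r0 : 0 < r by rewrite divr_gt0.
have re : r < e by rewrite /r; lra.
have inball (x : 'rV[R]_n) rho : rho <= r -> (forall i, `|x ord0 i - a ord0 i| <= rho) ->
    multi_series_to (fun al => c al * monomial (x - a) al) (f x).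
  move=> rhor xa; apply: fc; split => // i j; rewrite ord1 /ball /= distrC.
  by apply: le_lt_trans (xa j) _; apply: le_lt_trans rhor re.
have [/cvg_ex [/= S cvS] _] : multi_series_to
    (fun al => c al * monomial (a + const_mx r - a) al) (f (a + const_mx r)).
  apply: (inball _ r) => // i.
  by rewrite !mxE addrAC subrr add0r gtr0_norm.
have Sb := cvgr_norm_le _ cvS (`|S| + 1).
pose g i := c (mdeg1 i); exists g.
have key (x : 'rV[R]_n) rho : 0 <= rho <= r -> (forall i, `|x ord0 i - a ord0 i| <= rho) ->
    `|f x - (c [ffun=> 0%N] + \sum_i g i * (x ord0 i - a ord0 i))| <=
      (`|S| + 1) * (rho / r) ^+ 2.
  move=> /andP[rho0 rhor] xa; have [_ fx] := inball x rho rhor xa.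
  set L := (X in f x - X).
  have hle i : `|(x - a) ord0 i| <= rho by rewrite !mxE.
  apply: (ler_cvg_to (cvg_norm (cvgB fx (cvg_cst L)))
    (cvg_cst ((`|S| + 1) * (rho / r) ^+ 2))).
  near=> N => /=; rewrite -[X in `|X|]/(box_sum _ _ - _).
  have N2 : (1 < N)%N by near: N; exact: nbhs_infty_gt.
  have SN : box_sum (fun al => `|c al * monomial (a + const_mx r - a) al|) N <= `|S| + 1.
    by apply: le_trans (ler_norm _) _; near: N; apply: Sb; rewrite ltrDl ltr01.
  have NE : N = N.-2.+2 by rewrite -subn2 -addn2 subnK.
  rewrite NE in SN *.
  rewrite box_sum_degree monomial0 mulr1.
  under eq_bigr => i _ do rewrite monomial_mdeg1 !mxE.
  rewrite -/L addrAC subrr add0r (le_trans (ler_norm_sum _ _ _)) //.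
  rewrite mulrC; apply: le_trans (ler_wpM2l _ SN); last by rewrite sqr_ge0.
  rewrite /box_sum mulr_sumr big_mkcond; apply: ler_sum => al _ /=.
  set al' := [ffun i => _].
  case: ifPn => dal; last by rewrite mulr_ge0 // sqr_ge0.
  rewrite [a + _ - a]addrAC subrr add0r !normrM mulrCA ler_wpM2l //.
  rewrite monomial_const normrX (gtr0_norm r0).
  apply: le_trans (normr_monomial_le _ hle) _.
  have -> : (\sum_i al' i = \sum_i al i)%N by apply: eq_bigr => i _; rewrite ffunE.
  move: (\sum_i _)%N dal => d dal.
  rewrite -(subnKC dal) !exprD mulrA -exprMn divfK ?gt_eqF //.
  by rewrite ler_wpM2l ?sqr_ge0 ?lerXn2r ?nnegrE // ltW.
exists ((`|S| + 1) / r ^+ 2), r; split => // x rho rhor xa.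
(* The case [rho = 0] of [key] identifies the constant coefficient with [f a]. *)
have : `|f a - c [ffun=> 0%N]| <= 0.
  have := key a 0; rewrite lexx (ltW r0) mul0r expr0n mulr0 => /(_ isT).
  under eq_bigr => i _ do rewrite subrr mulr0.
  by rewrite big1 // addr0; apply => i; rewrite subrr normr0.
rewrite normr_le0 subr_eq0 => /eqP ->.
rewrite -addrA -opprD; apply: le_trans (key x rho rhor xa) _.
by rewrite expr_div_n mulrA mulrAC.
Unshelve. all: by end_near. Qed.

(** * Velocities of curves and their transport by analytic maps *)

Definition velocity (R : realType) (n : nat) (z : R -> 'rV[R]_n)
    (p w : 'rV[R]_n) : Prop :=
  forall i, s^-1 * (z s ord0 i - p ord0 i) @[s --> 0^'] --> w ord0 i.

(** The curve is two-sided and needs no regularity beyond a velocity at 0; its value at 0 is left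
    free. *)
Definition tangent (R : realType) (n : nat) (M : set 'rV[R]_n)
    (p w : 'rV[R]_n) : Prop :=
  exists z : R -> 'rV[R]_n,
    (\forall s \near 0^', M (z s)) /\ velocity z p w.

Lemma near0_dnbhs_neq0 (R : realType) : \forall s \near (0 : R)^', s != 0.
Proof. exact: nbhs_dnbhs_neq. Qed.

Lemma cvg_id_dnbhs0 (R : realType) : s @[s --> (0 : R)^'] --> (0 : R).
Proof. exact: nbhs_dnbhs. Qed.

Lemma velocity_cvg (R : realType) (n : nat) (z : R -> 'rV[R]_n)
    (p w : 'rV[R]_n) : velocity z p w -> z s @[s --> 0^'] --> p.
Proof.
move=> zw; apply/cvg_ballP => e e0.
have zi i : \forall s \near 0^', ball (p ord0 i) e (z s ord0 i).
  have zi : p ord0 i + s * (s^-1 * (z s ord0 i - p ord0 i)) @[s --> 0^']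
      --> p ord0 i + 0 * w ord0 i.
    exact: (cvgD (cvg_cst _) (cvgM (@cvg_id_dnbhs0 R) (zw i))).
  rewrite mul0r addr0 in zi.
  move: zi => /cvg_ballP /(_ _ e0); apply: filterS2 (near0_dnbhs_neq0 R) => s s0.
  by rewrite mulVKf // addrC subrK.
have zall : \forall s \near 0^', forall i, ball (p ord0 i) e (z s ord0 i).
  exact: filter_forall.
by apply: filterS zall => s zs; split => // i j; rewrite !ord1.
Qed.

(** Chain rule: the gradient [g] is chosen before the curve, so velocities are transported linearly.
    The Taylor bound with [rho = |s| * K] makes the remainder O(s^2), which vanishes in the limit
    after division by s. *)
Lemma velocity_analytic_coord (R : realType) (n : nat) (f : 'rV[R]_n -> R)
    (p : 'rV[R]_n) : analytic_at f p ->
  exists g : 'I_n -> R, forall z w, velocity z p w ->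
    s^-1 * (f (z s) - f p) @[s --> 0^'] --> \sum_i w ord0 i * g i.
Proof.
move=> /analytic_at_taylor1 [g [C [r [r0 fg]]]]; exists g => z w zw.
pose lin s := \sum_i s^-1 * (z s ord0 i - p ord0 i) * g i.
have lin_cvg : lin s @[s --> 0^'] --> \sum_i w ord0 i * g i.
  apply: cvg_big => [|i _]; first exact: add_continuous.
  exact: (cvgM (zw i) (cvg_cst _)).
(* Strictly larger than every |w_i|, hence eventually a bound on all difference quotients. *)
pose K := \sum_i `|w ord0 i| + 1.
have K0 : 0 < K by rewrite ltr_wpDl // sumr_ge0.
have zK : \forall s \near 0^', forall i, `|s^-1 * (z s ord0 i - p ord0 i)| <= K.
  apply: filter_forall => i; apply: cvgr_norm_le (zw i) _ _.
  by rewrite /K (bigD1 i) //= -addrA ltrDl ltr_wpDl // sumr_ge0.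
have rem_cvg : s^-1 * (f (z s) - f p) - lin s @[s --> 0^'] --> (0 : R).
  have bound_cvg : C * K ^+ 2 * `|s| @[s --> (0 : R)^'] --> (0 : R).
    have := cvgM (cvg_cst (C * K ^+ 2)) (cvg_norm (@cvg_id_dnbhs0 R)).
    by rewrite normr0 mulr0; apply.
  apply: norm_cvg0; apply: (squeeze_cvgr _ (cvg_cst 0) bound_cvg).
  near=> s; rewrite normr_ge0 /=.
  have s0 : s != 0 by near: s; exact: near0_dnbhs_neq0.
  have sr : `|s| * K <= r.
    rewrite -ler_pdivlMr //; near: s; apply: dnbhs0_le; exact: divr_gt0.
  have sK : 0 <= `|s| * K <= r by rewrite sr mulr_ge0 // ltW.
  have remP := fg (z s) _ sK.
  pose rem := f (z s) - f p - \sum_i g i * (z s ord0 i - p ord0 i).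
  have -> : s^-1 * (f (z s) - f p) - lin s = s^-1 * rem.
    rewrite /rem /lin [RHS]mulrBr mulr_sumr; congr (_ - _).
    by apply: eq_bigr => i _; rewrite -mulrA [_ * g i]mulrC.
  rewrite normrM normfV ler_pdivrMl ?normr_gt0 //.
  apply: le_trans (remP _) _; last first.
    by rewrite (_ : C * _ = `|s| * (C * K ^+ 2 * `|s|)) //; ring.
  move=> i; rewrite -ler_pdivrMl ?normr_gt0 // -normfV -normrM.
  by move: i; near: s.
exact: (cvg_sub0 rem_cvg lin_cvg).
Unshelve. all: by end_near. Qed.

Lemma velocity_analytic (R : realType) (n m : nat) (f : 'rV[R]_n -> 'rV[R]_m)
    (p : 'rV[R]_n) : (forall j, analytic_at (fun x => f x ord0 j) p) ->
  exists G : 'M[R]_(n, m), forall z w, velocity z p w ->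
    velocity (f \o z) (f p) (w *m G).
Proof.
move=> fA; have [g gP] := choice (fun j => velocity_analytic_coord (fA j)).
exists (\matrix_(i, j) g j i) => z w zw j; rewrite mxE.
under eq_bigr => i _ do rewrite mxE.
exact: gP.
Qed.

Lemma velocity_unique (R : realType) (n : nat) (z : R -> 'rV[R]_n) (p w w' : 'rV[R]_n) :
  velocity z p w -> velocity z p w' -> w = w'.
Proof.
move=> zw zw'; apply/rowP => i.
exact: (cvg_unique (@norm_hausdorff _ R) (zw i) (zw' i)).
Qed.

Lemma velocity_near_eq (R : realType) (n : nat) (z z' : R -> 'rV[R]_n)
    (p w : 'rV[R]_n) : (\forall s \near 0^', z s = z' s) ->
  velocity z p w -> velocity z' p w.
Proof.
move=> zz' zw i; apply: cvg_trans (zw i); apply: near_eq_cvg.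
by apply: filterS zz' => s ->.
Qed.

Lemma velocity_line (R : realType) (n : nat) (p w : 'rV[R]_n) :
  velocity (fun s => p + s *: w) p w.
Proof.
move=> i; have cst : w ord0 i @[s --> (0 : R)^'] --> w ord0 i by exact: cvg_cst.
apply: cvg_trans cst; apply: near_eq_cvg.
apply: filterS (near0_dnbhs_neq0 R) => s s0.
by rewrite !mxE addrAC subrr add0r mulKf.
Qed.

(** * Tangent vectors at manifold points *)

(** With G and H the derivatives of the chart and its inverse, a tangent w satisfies wGH = w, and wG
    lies in the coordinate subspace of the slice. Both conditions are linear, so they pass to the
    difference w; the inverse chart then carries the line through [phi p] in direction wG to a curve
    in M with velocity wGH = w. *)
Lemma submanifold_tangentB (R : realType) (n d : nat) (M : set 'rV[R]_n)
    (p w1 w2 : 'rV[R]_n) : analytic_submanifold d M -> M p ->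
  tangent M p w1 -> tangent M p w2 -> tangent M p (w1 - w2).
Proof.
move=> Msub Mp T1 T2.
have [U [V [phi [Up [openU openV phiU phiA [psi [psiA psiK]]] MU]]]] := Msub p Mp.
have [G GP] := velocity_analytic (phiA p Up).
have Vp : V (phi p) by rewrite -phiU; exists p.
have [H HP] := velocity_analytic (psiA _ Vp).
rewrite psiK // in HP.
have tanP w : tangent M p w ->
    w *m G *m H = w /\ forall i : 'I_n, (d <= i)%N -> (w *m G) ord0 i = 0.
  move=> [z [Mz zw]].
  have Uz : \forall s \near 0^', U (z s).
    by apply: (velocity_cvg zw); apply: open_nbhs_nbhs.
  split.
    apply: (velocity_unique _ zw); apply: velocity_near_eq (HP _ _ (GP _ _ zw)).
    by apply: filterS Uz => s Us /=; rewrite psiK.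
  have phi0 x : M x -> U x -> forall i : 'I_n, (d <= i)%N -> phi x ord0 i = 0.
    by move=> Mx Ux; have : (M `&` U) x by []; rewrite MU => -[].
  move=> i di; have := GP _ _ zw i.
  have cst0 : (0 : R) @[s --> (0 : R)^'] --> (0 : R) by exact: cvg_cst.
  move=> zi; apply: (cvg_unique (@norm_hausdorff _ R) zi).
  apply: cvg_trans cst0; apply: near_eq_cvg.
  apply: filterS2 Mz Uz => s Ms Us /=.
  by rewrite !phi0 // subrr mulr0.
have [w1K w1G] := tanP _ T1; have [w2K w2G] := tanP _ T2.
pose w := w1 - w2; pose y (s : R) := phi p + s *: (w *m G).
have yw : velocity y (phi p) (w *m G) by exact: velocity_line.
exists (psi \o y); split; last first.
  have := HP _ _ yw; suff -> : w *m G *m H = w by [].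
  by rewrite /w !mulmxBl w1K w2K.
have Vy : \forall s \near 0^', V (y s).
  by apply: (velocity_cvg yw); apply: open_nbhs_nbhs.
apply: filterS Vy => s; rewrite -phiU => -[x Ux xy] /=.
rewrite -xy psiK //.
suff : (M `&` U) x by case.
rewrite MU; split => // i di; rewrite xy /y mxE [X in _ + X]mxE.
have : (M `&` U) p by [].
rewrite MU => -[_ ->] //.
by rewrite add0r /w mulmxBl mxE w1G // mxE w2G // subrr mulr0.
Qed.

Lemma tangent_open (R : realType) (n : nat) (M U : set 'rV[R]_n)
    (p w : 'rV[R]_n) : open U -> U p -> tangent M p w -> tangent (M `&` U) p w.
Proof.
move=> openU Up [z [Mz zw]]; exists z; split => //.
have Uz : \forall s \near 0^', U (z s).
  by apply: (velocity_cvg zw); apply: open_nbhs_nbhs.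
by apply: filterS2 Mz Uz => s Ms Us; split.
Qed.

Lemma manifold_point_tangentB (R : realType) (n : nat) (X : set 'rV[R]_n)
    (p w1 w2 : 'rV[R]_n) : manifold_point X p ->
  tangent X p w1 -> tangent X p w2 -> tangent X p (w1 - w2).
Proof.
move=> [Xp [U [openU Up [d _ sub]]]] T1 T2.
have [z [Xz zw]] := submanifold_tangentB sub (conj Xp Up)
  (tangent_open openU Up T1) (tangent_open openU Up T2).
by exists z; split => //; apply: filterS Xz => s [].
Qed.

(** * The linkage at its flat configuration *)

Lemma tangent_row4 (R : realType) (M : set 'rV[R]_4) (x0 y0 u0 v0 : R)
    (x1 y1 u1 v1 : R) (x y u v : R -> R) :
  (\forall s \near 0^', M (row4 (x s) (y s) (u s) (v s))) ->
  s^-1 * (x s - x0) @[s --> 0^'] --> x1 ->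
  s^-1 * (y s - y0) @[s --> 0^'] --> y1 ->
  s^-1 * (u s - u0) @[s --> 0^'] --> u1 ->
  s^-1 * (v s - v0) @[s --> 0^'] --> v1 ->
  tangent M (row4 x0 y0 u0 v0) (row4 x1 y1 u1 v1).
Proof.
move=> Mz cx cy cu cv; exists (fun s => row4 (x s) (y s) (u s) (v s)).
split => // -[[|[|[|[|//]]]] i4]; rewrite !mxE /=.
- by apply: cvg_trans cx; apply: near_eq_cvg; apply: nearW => s; rewrite !mxE.
- by apply: cvg_trans cy; apply: near_eq_cvg; apply: nearW => s; rewrite !mxE.
- by apply: cvg_trans cu; apply: near_eq_cvg; apply: nearW => s; rewrite !mxE.
- by apply: cvg_trans cv; apply: near_eq_cvg; apply: nearW => s; rewrite !mxE.
Qed.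

Lemma row4E (R : realType) (x y u v : R) :
  [/\ row4 x y u v ord0 0 = x, row4 x y u v ord0 1 = y,
      row4 x y u v ord0 2 = u & row4 x y u v ord0 3 = v].
Proof. by split; rewrite mxE. Qed.

(* Along a curve in the linkage with velocity (0, 0, 0, k), the equations give
   u ~ a + b - (k s)^2 / 2c, u - x ~ b - (k s)^2 / 2b and x = a + o(s^2), which
   would force b = c, that is a = 2. *)
Lemma fourbar_not_tangent (R : realType) (a b c k : R) :
  a != 0 -> c = a + b - 2 -> a != 2 -> k != 0 ->
  ~ tangent (fourbar_space a c b) (row4 a 0 (a + b) 0) (row4 0 0 0 k).
Proof.
move=> a0 cE a2 k0 [z [Xz zw]].
have [p0 p1 p2 p3] := row4E a 0 (a + b) 0.
have [w0 w1 w2 w3] := row4E 0 0 0 k.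
pose x s := s^-1 * (z s ord0 0 - a); pose y s := s^-1 * (z s ord0 1 - 0).
pose u s := s^-1 * (z s ord0 2 - (a + b)); pose v s := s^-1 * (z s ord0 3 - 0).
have cx : x s @[s --> 0^'] --> (0 : R) by have := zw 0; rewrite p0 w0.
have cy : y s @[s --> 0^'] --> (0 : R) by have := zw 1; rewrite p1 w1.
have cu : u s @[s --> 0^'] --> (0 : R) by have := zw 2; rewrite p2 w2.
have cv : v s @[s --> 0^'] --> k by have := zw 3; rewrite p3 w3.
have sq (f g : R -> R) (l m : R) : f s @[s --> 0^'] --> l ->
    g s @[s --> 0^'] --> m ->
    f s * f s + g s * g s @[s --> 0^'] --> l * l + m * m.
  by move=> cf cg; exact: (cvgD (cvgM cf cf) (cvgM cg cg)).
(* On the curve, [F s] is s^-2 (ab p2 - bc p1 - ac p3), hence 0. The weights cancel the linear terms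
   2c(su), 2a(sx), 2b(su - sx) of p2, p1, p3, so only quadratic terms remain and the limit is a k^2
   (b - c). *)
pose F s := a * b * (u s * u s + v s * v s) - b * c * (x s * x s + y s * y s) -
  a * c * ((u s - x s) * (u s - x s) + (v s - y s) * (v s - y s)).
have lim : F s @[s --> 0^'] --> a * b * (0 * 0 + k * k) -
    b * c * (0 * 0 + 0 * 0) - a * c * ((0 - 0) * (0 - 0) + (k - 0) * (k - 0)).
  exact: (cvgB (cvgB (cvgM (cvg_cst (a * b)) (sq _ _ _ _ cu cv))
    (cvgM (cvg_cst (b * c)) (sq _ _ _ _ cx cy)))
    (cvgM (cvg_cst (a * c)) (sq _ _ _ _ (cvgB cu cx) (cvgB cv cy)))).
rewrite !(subr0, mul0r, mulr0, add0r) in lim.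
have lim0 : (0 : R) @[s --> (0 : R)^'] --> (0 : R) by exact: cvg_cst.
have /eqP : a * b * (k * k) - a * c * (k * k) = 0.
  apply: (cvg_unique (@norm_hausdorff _ R) lim).
  apply: cvg_trans lim0; apply: near_eq_cvg.
  apply: filterS2 Xz (near0_dnbhs_neq0 R) => s [e1 e2 e3] s0.
  move: e1 e2 e3; rewrite /fourbar_p1 /fourbar_p2 /fourbar_p3 /=.
  rewrite /F /x /y /u /v.
  move: (z s ord0 0) (z s ord0 1) (z s ord0 2) (z s ord0 3) => X Y U V e1 e2 e3.
  have F0 : s^-1 ^+ 2 * (a * b * ((U - 2) ^+ 2 + V ^+ 2 - c ^+ 2) -
    b * c * (X ^+ 2 + Y ^+ 2 - a ^+ 2) -
    a * c * ((U - X) ^+ 2 + (V - Y) ^+ 2 - b ^+ 2)) = 0.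
    by rewrite e1 e2 e3; ring.
  by rewrite -[LHS]F0 cE; ring.
rewrite -mulrBl -mulrBr !mulf_eq0 (negPf a0) (negPf k0) /= !orbF cE.
by move=> /eqP bc; case/eqP: a2; move: bc; lra.
Qed.

(* The joint (u, v) lies on the circles of radius c about (2, 0) and of radius b
   about (x, y); lam and s * m are its coordinates in the frame formed by
   (x, y) - (2, 0) and its rotation by a right angle.  With x = a - s^2 all
   square roots are taken of quantities that stay positive near s = 0. *)
Lemma fourbar_branch (R : realType) (a b c e s S T q lam m : R) :
  c = a + b - 2 -> e ^+ 2 = 1 -> S ^+ 2 = 2 * a - s * s ->
  T ^+ 2 = b * c - s * s -> q = (a - 2) * (a - 2) + 4 * (s * s) -> q != 0 ->
  lam = 1 / 2 + (a - 2) * (c + b) / 2 * q^-1 -> m = 2 * e * T * q^-1 ->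
  let x := a - s * s in
  fourbar_space a c b (row4 x (s * S)
    (2 + lam * (x - 2) - s * m * (s * S)) (s * (lam * S + m * (x - 2)))).
Proof.
move=> cE e2 S2 T2 qE q0 lamE mE x.
have D : (x - 2) ^+ 2 + (s * S) ^+ 2 = q by rewrite exprMn S2 qE /x; ring.
(* Heron's formula for the triangle with sides b, c and sqrt q: since q - (b - c)^2 = 4 s^2, its
   squared area is s^2 (bc - s^2). The factor s leaves the root explicitly, and [e] is the sign
   choosing the branch. *)
have m2 : (s * m) ^+ 2 = 4 * (s * s) * (b * c - s * s) * q^-1 ^+ 2.
  transitivity (e ^+ 2 * (4 * (s * s) * T ^+ 2 * q^-1 ^+ 2)).
    by rewrite mE; ring.
  by rewrite e2 mul1r T2.
have Lc : (lam ^+ 2 + (s * m) ^+ 2) * q = c ^+ 2.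
  by rewrite m2 lamE cE; move: q0; rewrite qE => q0; field.
have Lb : ((lam - 1) ^+ 2 + (s * m) ^+ 2) * q = b ^+ 2.
  by rewrite m2 lamE cE; move: q0; rewrite qE => q0; field.
rewrite /fourbar_space /= /fourbar_p1 /fourbar_p2 /fourbar_p3.
have [-> -> -> ->] := row4E x (s * S)
  (2 + lam * (x - 2) - s * m * (s * S)) (s * (lam * S + m * (x - 2))).
split.
- by rewrite exprMn S2 /x; ring.
- by rewrite -Lc -D; ring.
- by rewrite -Lb -D; ring.
Qed.

(** The signs e = 1 and e = -1 give the two branches of the node. Since a differs from 2, [q] stays
    nonzero at s = 0, and the velocity follows from the limits of [S], [lam] and [m]. *)
Lemma fourbar_tangent (R : realType) (a b c e : R) :
  0 < a -> 0 < b -> 0 < c -> c = a + b - 2 -> a != 2 -> e ^+ 2 = 1 ->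
  tangent (fourbar_space a c b) (row4 a 0 (a + b) 0)
    (row4 0 (Num.sqrt (2 * a)) 0
      ((c * Num.sqrt (2 * a) + 2 * e * Num.sqrt (b * c)) / (a - 2))).
Proof.
move=> a0 b0 c0 cE a2 e2.
have a2' : a - 2 != 0 by rewrite subr_eq0.
have q0_gt0 : 0 < (a - 2) * (a - 2) by rewrite -expr2 lt0r sqr_ge0 expf_neq0.
have q_neq0 s : (a - 2) * (a - 2) + 4 * (s * s) != 0.
  by rewrite gt_eqF // ltr_wpDr // mulr_ge0 // -expr2 sqr_ge0.
pose S (s : R) : R := Num.sqrt (2 * a - s * s); pose T (s : R) : R := Num.sqrt (b * c - s * s).
pose q s := (a - 2) * (a - 2) + 4 * (s * s).
pose lam s := 1 / 2 + (a - 2) * (c + b) / 2 * (q s)^-1.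
pose m (s : R) : R := 2 * e * T s * (q s)^-1.
have id0 := @cvg_id_dnbhs0 R.
have sq0 : s * s @[s --> (0 : R)^'] --> (0 : R).
  by have := cvgM id0 id0; rewrite mulr0; apply.
have cB (k : R) : k - s * s @[s --> (0 : R)^'] --> k.
  by have := cvgB (cvg_cst k) sq0; rewrite subr0; apply.
have cS : S s @[s --> (0 : R)^'] --> Num.sqrt (2 * a).
  by apply: continuous_cvg (cB (2 * a)); exact: sqrt_continuous.
have cT : T s @[s --> (0 : R)^'] --> Num.sqrt (b * c).
  by apply: continuous_cvg (cB (b * c)); exact: sqrt_continuous.
have cq : (q s)^-1 @[s --> (0 : R)^'] --> ((a - 2) * (a - 2))^-1.
  apply: cvgV; first by rewrite gt_eqF.
  have := cvgD (cvg_cst ((a - 2) * (a - 2))) (cvgM (cvg_cst (4 : R)) sq0).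
  by rewrite mulr0 addr0; apply.
have clam : lam s @[s --> (0 : R)^'] --> c / (a - 2).
  have -> : c / (a - 2) =
      1 / 2 + (a - 2) * (c + b) / 2 * ((a - 2) * (a - 2))^-1.
    by rewrite cE; field.
  exact: (cvgD (cvg_cst _) (cvgM (cvg_cst _) cq)).
have cm : m s @[s --> (0 : R)^'] -->
    2 * e * Num.sqrt (b * c) * ((a - 2) * (a - 2))^-1.
  exact: (cvgM (cvgM (cvg_cst _) cT) cq).
pose x s := a - s * s.
apply: (@tangent_row4 _ _ _ _ _ _ _ _ _ _ x (fun s => s * S s)
  (fun s => 2 + lam s * (x s - 2) - s * m s * (s * S s))
  (fun s => s * (lam s * S s + m s * (x s - 2)))).
- have posB (k : R) : 0 < k -> \forall s \near (0 : R)^', 0 < k - s * s.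
    by move=> k0; apply: cvgr_gt (cB k) _ k0.
  have S_pos := posB _ (mulr_gt0 (ltr0Sn R 1) a0).
  have T_pos := posB _ (mulr_gt0 b0 c0).
  apply: filterS2 S_pos T_pos => s s1 s2.
  apply: (fourbar_branch (e := e) (T := T s) (q := q s)) => //.
  + by rewrite sqr_sqrtr // ltW.
  + by rewrite sqr_sqrtr // ltW.
  + exact: q_neq0.
- have lim : - s @[s --> (0 : R)^'] --> (0 : R).
    by have := cvgN id0; rewrite oppr0; apply.
  apply: cvg_trans lim; apply: near_eq_cvg.
  by apply: filterS (near0_dnbhs_neq0 R) => s s0; rewrite /x; field.
- apply: cvg_trans cS; apply: near_eq_cvg.
  by apply: filterS (near0_dnbhs_neq0 R) => s s0; rewrite subr0 mulKf.
(* The u-coordinate differs from a + b by s^2 times the bracket, because a - 2 = c - b; its velocity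
   is therefore 0. *)
- have lim : s * (- 2 * (c + b) * (q s)^-1 - lam s - m s * S s)
      @[s --> (0 : R)^'] --> (0 : R).
    have := cvgM id0 (cvgB (cvgB (cvgM (cvg_cst (- 2 * (c + b))) cq) clam)
      (cvgM cm cS)).
    by rewrite mul0r; apply.
  apply: cvg_trans lim; apply: near_eq_cvg.
  apply: filterS (near0_dnbhs_neq0 R) => s s0.
  by rewrite /lam /x /q cE; field; rewrite s0 q_neq0.
- have lim : lam s * S s + m s * (x s - 2) @[s --> (0 : R)^'] -->
      (c * Num.sqrt (2 * a) + 2 * e * Num.sqrt (b * c)) / (a - 2).
    have -> : (c * Num.sqrt (2 * a) + 2 * e * Num.sqrt (b * c)) / (a - 2) =
        c / (a - 2) * Num.sqrt (2 * a) +
        2 * e * Num.sqrt (b * c) * ((a - 2) * (a - 2))^-1 * (a - 2).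
      by field.
    exact: (cvgD (cvgM clam cS) (cvgM cm (cvgB (cB a) (cvg_cst (2 : R))))).
  apply: cvg_trans lim; apply: near_eq_cvg.
  by apply: filterS (near0_dnbhs_neq0 R) => s s0; rewrite subr0 mulKf.
Qed.

Theorem mainTheorem3 (R : realType) (l2 l3 l4 : R)
  (l2_gt0 : 0 < l2) (l3_gt0 : 0 < l3) (l4_gt0 : 0 < l4)
  (l3E : l3 = l2 + l4 - 2)
  (l2_neq2 : l2 <> 2) (l4_neq2 : l4 <> 2) (l2_neq83 : l2 <> 8 / 3) :
  fourbar_space l2 l3 l4 (row4 l2 0 (l2 + l4) 0) /\
  ~ manifold_point (fourbar_space l2 l3 l4) (row4 l2 0 (l2 + l4) 0).
Proof.
have l2_neq2' : l2 != 2 by apply/eqP.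
split.
  rewrite /fourbar_space /= /fourbar_p1 /fourbar_p2 /fourbar_p3.
  have [-> -> -> ->] := row4E l2 0 (l2 + l4) 0.
  by rewrite l3E; split; ring.
move=> Xp.
have N1 : (-1 : R) ^+ 2 = 1 by rewrite sqrrN expr1n.
have tan e : e ^+ 2 = 1 -> tangent _ _ _ :=
  fourbar_tangent l2_gt0 l4_gt0 l3_gt0 l3E l2_neq2'.
have := manifold_point_tangentB Xp (tan 1 (expr1n _ _)) (tan (-1) N1).
(* In the difference of the two branch velocities only the terms carrying the sign e survive, and
   they add up. *)
set k : R := 4 * Num.sqrt (l4 * l3) / (l2 - 2).
have -> : row4 0 (Num.sqrt (2 * l2)) 0
    ((l3 * Num.sqrt (2 * l2) + 2 * 1 * Num.sqrt (l4 * l3)) / (l2 - 2)) -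
  row4 0 (Num.sqrt (2 * l2)) 0
    ((l3 * Num.sqrt (2 * l2) + 2 * -1 * Num.sqrt (l4 * l3)) / (l2 - 2)) =
  row4 0 0 0 k.
  apply/rowP => -[[|[|[|[|//]]]] i4]; rewrite !mxE /= ?subrr //.
  by rewrite /k; field; rewrite subr_eq0.
apply: fourbar_not_tangent => //; first by rewrite gt_eqF.
rewrite !mulf_neq0 ?invr_eq0 ?subr_eq0 ?pnatr_eq0 //.
by rewrite gt_eqF // sqrtr_gt0 mulr_gt0.
Qed.
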